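(* Let $\mathcal{L}$ be a real closed valued field with convex valuation and value group $\Gamma$, and let $A\in {\operatorname{\mathsf{TPD}}}_n(\mathbb{S}_{\max}^{\vee})$. Let ${\bf A}$ be a symmetric positive definite matrix over $\mathcal{L}$ such that $\mathrm{sv}({\bf A})= A$. Then, the signed valuations of the eigenvalues of ${\bf A}$, counted with multiplicities, coincide with the algebraic $\mathbb{S}_{\max}$-eigenvalues of $A$, that is the diagonal entries of $A$.
   Context: $\Gamma$ is a divisible totally ordered abelian group and $\mathbb{S}_{\max}=\mathbb{S}_{\max}(\Gamma)$ the symmetrized tropical semiring, with zero $\mathbf{0}$, unit $\mathbf{1}$, minus operator $\ominus$; $\mathbb{S}_{\max}^\vee$ (resp. $\mathbb{S}_{\max}^\oplus$) is the set of signed elements (resp. positive elements and $\mathbf{0}$), and $a\,\nabla\, b$ iff $a\ominus b$ is balanced; $a<b$ iff $b\ominus a\in\mathbb{S}_{\max}^\oplus\setminus\{\mathbf{0}\}$. $A\in{\operatorname{\mathsf{TPD}}}_n(\mathbb{S}_{\max}^\vee)$ means $A=(a_{ij})$ is symmetric with entries in $\mathbb{S}_{\max}^\vee$ and $\mathbf{0}<x^TAx$ for all nonzero $x\in(\mathbb{S}_{\max}^\vee)^n$ (equivalently $\mathbf{0}<a_{ii}$, $a_{ij}^2<a_{ii}a_{jj}$ for $i\ne j$). For an ordered field $\mathcal{L}$ with convex valuation $\mathrm v:\mathcal{L}\to\Gamma\cup\{\bot\}$, the signed valuation is $\mathrm{sv}(b)=\mathrm{sgn}(b)\odot\mathrm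 v(b)\in\mathbb{S}_{\max}^\vee$, where $\mathrm{sgn}(b)$ is $\mathbf{1}$, $\ominus\mathbf{1}$ or $\mathbf{0}$ according as $b>0$, $b<0$ or $b=0$; it is applied entrywise to matrices. The algebraic $\mathbb{S}_{\max}$-eigenvalues of $A$ are the $\gamma\in\mathbb{S}_{\max}^\vee$ with $\det(\gamma I\ominus A)\,\nabla\,\mathbf{0}$, counted with multiplicity as roots of the characteristic polynomial $\det(\mathsf{X} I\ominus A)$ (multiplicity $\mathrm{mult}_r(P)=1+\max\{\mathrm{mult}_r(Q): P\,\nabla\,(\mathsf{X}\ominus r)Q\}$ for a root $r$, $Q$ ranging over polynomials with signed coefficients). *)

(* Defs.v *)
From HB Require Import structures.
From mathcomp Require Import all_boot all_order all_algebra all_fingroup.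
From mathcomp Require Import polyrcf.

Set Implicit Arguments.
Unset Strict Implicit.
Unset Printing Implicit Defensive.

Import Order.TTheory GRing.Theory Num.Theory.

(* Gamma is given as a partially ordered zmodule (porderZmodType, order in
   ring_display) together with the hypotheses that the order is total and
   translation invariant. *)
Notation ordZmodType := porderZmodType.

Definition totally_ordered_abelian_group (G : ordZmodType) : Prop :=
  (forall x y : G, ((x <= y)%R || (y <= x)%R)) /\
  (forall x y z : G, (x <= y)%R -> (x + z <= y + z)%R).

Definition divisible_group (G : ordZmodType) : Prop :=
  forall (x : G) (k : nat), (0 < k)%N -> exists y : G, (y *+ k)%R = x.

(* sign tags: positive (+), negative (-), balanced (•) *)
Inductive stag := SPl | SMi | SBa.

Definition stag_enc (s : stag) : option bool :=
  match s with SPl => Some true | SMi => Some false | SBa => None end.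
Definition stag_dec (o : option bool) : stag :=
  match o with Some true => SPl | Some false => SMi | None => SBa end.
Lemma stag_encK : cancel stag_enc stag_dec. Proof. by case. Qed.
HB.instance Definition _ := Equality.copy stag (can_type stag_encK).

Inductive smax (G : ordZmodType) :=
  | SZero
  | SElt of stag & G.
Arguments SZero {G}.

Definition smax_enc (G : ordZmodType) (x : smax G) : option (stag * G) :=
  match x with SZero => None | SElt s a => Some (s, a) end.
Definition smax_dec (G : ordZmodType) (o : option (stag * G)) : smax G :=
  match o with None => SZero | Some (s, a) => SElt s a end.
Lemma smax_encK (G : ordZmodType) : cancel (@smax_enc G) (@smax_dec G).
Proof. by case. Qed.
HB.instance Definition _ (G : ordZmodType) :=
  Equality.copy (smax G) (can_type (@smax_encK G)).

Definition stag_add (s t : stag) : stag :=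
  match s, t with
  | SPl, SPl => SPl
  | SMi, SMi => SMi
  | _, _ => SBa
  end.

Definition stag_mul (s t : stag) : stag :=
  match s, t with
  | SBa, _ => SBa
  | _, SBa => SBa
  | SPl, SPl => SPl
  | SMi, SMi => SPl
  | _, _ => SMi
  end.

Definition sadd (G : ordZmodType) (x y : smax G) : smax G :=
  match x, y with
  | SZero, _ => y
  | _, SZero => x
  | SElt s a, SElt t b =>
      if (a < b)%R then y else if (b < a)%R then x else SElt (stag_add s t) a
  end.

Definition smul (G : ordZmodType) (x y : smax G) : smax G :=
  match x, y with
  | SElt s a, SElt t b => SElt (stag_mul s t) (a + b)%R
  | _, _ => SZero
  end.

Definition sone (G : ordZmodType) : smax G := SElt SPl 0%R.

Definition sopp (G : ordZmodType) (x : smax G) : smax G :=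
  match x with
  | SZero => SZero
  | SElt SPl a => SElt SMi a
  | SElt SMi a => SElt SPl a
  | SElt SBa a => SElt SBa a
  end.

Definition ssub (G : ordZmodType) (x y : smax G) : smax G := sadd x (sopp y).

Definition sbalanced (G : ordZmodType) (x : smax G) : bool :=
  match x with SZero => true | SElt SBa _ => true | _ => false end.

Definition ssigned (G : ordZmodType) (x : smax G) : bool :=
  match x with SElt SBa _ => false | _ => true end.

Definition spos_nz (G : ordZmodType) (x : smax G) : bool :=
  match x with SElt SPl _ => true | _ => false end.

Definition snabla (G : ordZmodType) (x y : smax G) : bool :=
  sbalanced (ssub x y).

Definition slt (G : ordZmodType) (x y : smax G) : bool :=
  spos_nz (ssub y x).

Definition squad (G : ordZmodType) n (A : 'M[smax G]_n) (x : 'I_n -> smax G)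
  : smax G :=
  \big[@sadd G/SZero]_(i < n) \big[@sadd G/SZero]_(j < n)
     smul (smul (x i) (A i j)) (x j).

Definition TPD (G : ordZmodType) n (A : 'M[smax G]_n) : Prop :=
  trmx A = A /\
  (forall i j, ssigned (A i j)) /\
  (forall x : 'I_n -> smax G,
      (forall i, ssigned (x i)) -> (exists i, x i <> SZero) ->
      slt SZero (squad A x)).

Definition spsign (G : ordZmodType) n (s : 'S_n) : smax G :=
  if odd_perm s then sopp (sone G) else sone G.

Definition sdet (G : ordZmodType) n (M : 'M[smax G]_n) : smax G :=
  \big[@sadd G/SZero]_(s : 'S_n)
     smul (spsign G s) (\big[@smul G/sone G]_(i < n) M i (s i)).

Definition sshift (G : ordZmodType) n (g : smax G) (A : 'M[smax G]_n)
  : 'M[smax G]_n :=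
  \matrix_(i, j) ssub (if i == j then g else SZero) (A i j).

(* Formal polynomials over S_max (coefficient lists, lowest degree first)   *)

Definition spoly (G : ordZmodType) := seq (smax G).

Definition scoef (G : ordZmodType) (p : spoly G) (i : nat) : smax G :=
  nth SZero p i.

Definition spadd (G : ordZmodType) (p q : spoly G) : spoly G :=
  mkseq (fun i => sadd (scoef p i) (scoef q i)) (maxn (size p) (size q)).

Definition spmul (G : ordZmodType) (p q : spoly G) : spoly G :=
  mkseq (fun k => \big[@sadd G/SZero]_(i < k.+1)
                     smul (scoef p i) (scoef q (k - i)))
        (size p + size q).-1.

Definition spscale (G : ordZmodType) (c : smax G) (p : spoly G) : spoly G :=
  map (smul c) p.

Definition sXsub (G : ordZmodType) (r : smax G) : spoly G :=
  [:: sopp r; sone G].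

Definition spow (G : ordZmodType) (x : smax G) (k : nat) : smax G :=
  iter k (smul x) (sone G).

Definition speval (G : ordZmodType) (p : spoly G) (x : smax G) : smax G :=
  \big[@sadd G/SZero]_(i < size p) smul (scoef p i) (spow x i).

Definition spnabla (G : ordZmodType) (p q : spoly G) : Prop :=
  forall i, snabla (scoef p i) (scoef q i).

Definition scharpoly (G : ordZmodType) n (A : 'M[smax G]_n) : spoly G :=
  \big[@spadd G/[::]]_(s : 'S_n)
     spscale (spsign G s)
       (\big[@spmul G/[:: sone G]]_(i < n)
           (if i == s i then sXsub (A i (s i)) else [:: sopp (A i (s i))])).

(* smult_ge k P r : the multiplicity of r as a root of P is at least k, where
   mult_r(P) = 0 if P(r) is not balanced, and otherwise
   mult_r(P) = 1 + max { mult_r(Q) : Q with signed coefficients, P ∇ (X ⊖ r) Q }. *)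
Fixpoint smult_ge (G : ordZmodType) (k : nat) (p : spoly G) (r : smax G)
  : Prop :=
  match k with
  | 0 => True
  | k'.+1 =>
      sbalanced (speval p r) /\
      (k' = 0 \/
       exists q : spoly G, all (@ssigned G) q /\
                 spnabla p (spmul (sXsub r) q) /\ smult_ge k' q r)
  end.

Definition smult (G : ordZmodType) (p : spoly G) (r : smax G) (m : nat) : Prop :=
  smult_ge m p r /\ ~ smult_ge m.+1 p r.

Definition ole (G : ordZmodType) (a b : option G) : bool :=
  match a, b with
  | None, _ => true
  | Some _, None => false
  | Some x, Some y => (x <= y)%R
  end.

Definition oadd (G : ordZmodType) (a b : option G) : option G :=
  match a, b with
  | Some x, Some y => Some (x + y)%R
  | _, _ => None
  end.

(* v : L -> Gamma ∪ {⊥} is a (max-plus convention) valuation, convex, with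
   value group Gamma *)
Definition convex_valuation (L : realFieldType) (G : ordZmodType)
  (v : L -> option G) : Prop :=
  (forall x : L, v x = None <-> x = 0%R) /\
  (forall x y : L, v (x * y)%R = oadd (v x) (v y)) /\
  (forall x y : L, ole (v (x + y)%R) (v x) || ole (v (x + y)%R) (v y)) /\
  (forall x y : L, (0 < x)%R -> (x <= y)%R -> ole (v x) (v y)) /\
  (forall g : G, exists x : L, v x = Some g).

Definition ssgn (L : realFieldType) (G : ordZmodType) (b : L) : smax G :=
  if (0 < b)%R then sone G else if (b < 0)%R then sopp (sone G) else SZero.

Definition sof_val (G : ordZmodType) (a : option G) : smax G :=
  match a with None => SZero | Some g => SElt SPl g end.

Definition sv (L : realFieldType) (G : ordZmodType) (v : L -> option G)
  (b : L) : smax G :=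
  smul (ssgn G b) (sof_val (v b)).

(* Main.v *)
Require Import Defs.
From HB Require Import structures.
From mathcomp Require Import all_boot all_order all_algebra all_fingroup.
From mathcomp Require Import polyrcf complex spectral zify.

Import Order.TTheory GRing.Theory Num.Theory.
Local Open Scope ring_scope.

Set Implicit Arguments.
Unset Strict Implicit.
Unset Printing Implicit Defensive.

(** The test vector with entries [⊖ a_ij] and [a_ii] shows that a TPD matrix
    satisfies [a_ij^2 < a_ii a_jj].  Hence in every Leibniz expansion below the
    identity permutation strictly dominates.

    In the symmetrized semiring a strictly dominated term is absorbed, so the
    characteristic polynomial is the formal product of the [X ⊖ a_ii].  A root
    [r] occurring [m] times among the [a_ii] can be factored out [m] times.
    Conversely, Descartes' rule of signs shows that if [P ∇ (X ⊖ r) Q], then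
    the terms of [P] of maximal modulus at [r] have at least one sign change
    more than those of [Q]; so multiplicity [k] forces [k + 1] maximal terms,
    whereas the product has at most [m + 1] of them.

    Over the field, a symmetric matrix has a split characteristic polynomial,
    with positive roots in the definite case.  Evaluating it at [- t], [t > 0],
    gives [sum_i max (v t, v l_i) = sum_i max (v t, v a_ii)], and these sums for
    all values of [v t] determine the multiset. *)

(** * Ordered groups *)

Section OrderedGroup.
Variables (G : ordZmodType) (hG : totally_ordered_abelian_group G).
Implicit Types (x y z : G).

Lemma og_cmp x y : x >=< y.
Proof. by rewrite /Order.comparable; exact: (hG.1 x y). Qed.

Lemma og_leD2r z x y : (x + z <= y + z) = (x <= y).
Proof.
apply/idP/idP; last exact: hG.2.
by move/(hG.2 _ _ (- z)); rewrite !addrK.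
Qed.

Lemma og_ltD2r z x y : (x + z < y + z) = (x < y).
Proof. by rewrite !lt_def og_leD2r (inj_eq (addIr z)). Qed.

Lemma og_leD2l z x y : (z + x <= z + y) = (x <= y).
Proof. by rewrite ![z + _]addrC og_leD2r. Qed.

Lemma og_ltD2l z x y : (z + x < z + y) = (x < y).
Proof. by rewrite ![z + _]addrC og_ltD2r. Qed.

Lemma og_leD x y z t : x <= y -> z <= t -> x + z <= y + t.
Proof. by move=> h1 h2; apply: (@le_trans _ _ (y + z)); rewrite ?og_leD2r ?og_leD2l. Qed.

Lemma og_ltD x y z t : x < y -> z <= t -> x + z < y + t.
Proof. by move=> h1 h2; apply: (@lt_le_trans _ _ (y + z)); rewrite ?og_ltD2r ?og_leD2l. Qed.

Lemma og_double_lt x y : (x + x < y + y) = (x < y).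
Proof.
case: (comparable_ltgtP (og_cmp x y)) => [h|h|->]; last by rewrite ltxx.
  by rewrite og_ltD // ltW.
by apply/negbTE; rewrite (comparable_ltNge (og_cmp _ _)) negbK og_leD // ltW.
Qed.

Lemma og_sum_le (I : Type) (r : seq I) (f g : I -> G) :
  (forall i, f i <= g i) -> \sum_(i <- r) f i <= \sum_(i <- r) g i.
Proof.
move=> h; elim: r => [|a r ih]; first by rewrite !big_nil.
by rewrite !big_cons og_leD.
Qed.

Lemma og_sum_lt (I : eqType) (r : seq I) (f g : I -> G) (j : I) :
  (forall i, f i <= g i) -> j \in r -> f j < g j ->
  \sum_(i <- r) f i < \sum_(i <- r) g i.
Proof.
move=> h jr hj; rewrite (big_rem j) //= (big_rem j jr) /=.
by apply: og_ltD => //; apply: og_sum_le.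
Qed.

Lemma og_has_max (s : seq G) : s != [::] ->
  exists2 x, x \in s & forall y, y \in s -> y <= x.
Proof.
elim: s => // a [|b s] ih _; first by exists a; rewrite ?inE // => y; rewrite inE => /eqP->.
have [//|x xs hx] := ih.
case/orP: (og_cmp a x) => [ax|xa].
  exists x; first by rewrite inE xs orbT.
  by move=> y; rewrite inE => /orP[/eqP->|/hx].
exists a; first exact: mem_head.
by move=> y; rewrite inE => /orP[/eqP->//|/hx/le_trans]; apply.
Qed.

End OrderedGroup.

(** * The symmetrized semiring *)

Section Semiring.
Variables (G : ordZmodType) (hG : totally_ordered_abelian_group G).

Local Notation cmp x y := (comparable_ltgtP (og_cmp hG x y)).


Lemma sadd0x : left_id SZero (@sadd G).
Proof. by case. Qed.

Lemma sadd_lt (s t : stag) (a b : G) : a < b ->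
  sadd (SElt s a) (SElt t b) = SElt t b.
Proof. by rewrite /= => ->. Qed.

Lemma sadd_gt (s t : stag) (a b : G) : a < b ->
  sadd (SElt s b) (SElt t a) = SElt s b.
Proof. by move=> h; rewrite /= h lt_gtF. Qed.

Lemma sadd_eq (s t : stag) (a : G) :
  sadd (SElt s a) (SElt t a) = SElt (stag_add s t) a.
Proof. by rewrite /= ltxx. Qed.

Lemma saddC : commutative (@sadd G).
Proof.
case=> [|s a] [|t b] //=; case: (cmp a b) => // ->.
by case: s t => [] [].
Qed.

Lemma saddA : associative (@sadd G).
Proof.
move=> [|r a] [|s b] [|t c]; rewrite ?sadd0x ?[sadd _ SZero]saddC ?sadd0x //.
case: (cmp b c) => [bc|cb|<-]; case: (cmp a b) => [ab|ba|->].
- by rewrite !sadd_lt // (lt_trans ab).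
- by rewrite (sadd_lt _ _ bc) (sadd_gt _ _ ba).
- by rewrite sadd_eq !(sadd_lt _ _ bc).
- by rewrite (sadd_gt _ _ cb) (sadd_lt _ _ ab) (sadd_gt _ _ cb).
- by rewrite (sadd_gt _ _ cb) (sadd_gt _ _ ba) sadd_gt // (lt_trans cb).
- by rewrite (sadd_gt _ _ cb) sadd_eq sadd_gt.
- by rewrite sadd_eq !(sadd_lt _ _ ab) sadd_eq.
- by rewrite sadd_eq !(sadd_gt _ _ ba).
by rewrite !sadd_eq; case: r s t => [] [] [].
Qed.

Lemma smulC : commutative (@smul G).
Proof. by case=> [|s a] [|t b] //=; rewrite addrC; case: s t => [] []. Qed.

Lemma smulA : associative (@smul G).
Proof.
by move=> [|r a] [|s b] [|t c] //=; rewrite addrA; case: r s t => [] [] [].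
Qed.

Lemma smul1x : left_id (sone G) (@smul G).
Proof. by case=> [|s a] //=; rewrite add0r; case: s. Qed.

Lemma smulDl : left_distributive (@smul G) (@sadd G).
Proof.
move=> x y [|t c]; first by rewrite ![smul _ SZero]smulC.
case: x y => [|r a] [|s b] //; case: (cmp a b) => [ab|ba|<-].
- by rewrite sadd_lt //= og_ltD2r // ab.
- by rewrite sadd_gt //= !og_ltD2r // ba lt_gtF.
by rewrite sadd_eq /smul sadd_eq; case: r s t => [] [] [].
Qed.

Lemma sopp_mul (x y : smax G) : sopp (smul x y) = smul (sopp x) y.
Proof. by case: x y => [|[] a] [|[] b]. Qed.

Lemma sbalanced_mul (x y : smax G) :
  sbalanced (smul x y) = sbalanced x || sbalanced y.
Proof. by case: x y => [|[] a] [|[] b]. Qed.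

Lemma snabla_refl (x : smax G) : snabla x x.
Proof. by case: x => [|[] a]; rewrite /snabla /ssub /sopp ?sadd_eq. Qed.

Lemma snablax0 (x : smax G) : snabla x SZero = sbalanced x.
Proof. by rewrite /snabla /ssub saddC sadd0x. Qed.

End Semiring.

(* The semiring laws need the order of [G] to be total and translation
   invariant, so the instances live on a copy of [smax G] tagged by [hG]. *)
Definition smx (G : ordZmodType) (hG : totally_ordered_abelian_group G) : Type :=
  smax G.

Section SemiringInstance.
Variables (G : ordZmodType) (hG : totally_ordered_abelian_group G).
Local Notation S := (smx hG).

Definition smx_enc (x : S) : option (option bool * G) :=
  if x is SElt s a then Some (stag_enc s, a) else None.
Definition smx_dec (o : option (option bool * G)) : S :=
  if o is Some (s, a) then SElt (stag_dec s) a else SZero.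
Lemma smx_encK : cancel smx_enc smx_dec.
Proof. by case=> [|[] a]. Qed.
HB.instance Definition _ := Choice.copy S (can_type smx_encK).

HB.instance Definition _ := GRing.isNmodule.Build S
  (saddA hG) (saddC hG) (@sadd0x G).

Lemma sone_neq0 : (sone G : S) != 0.
Proof. by []. Qed.

HB.instance Definition _ := GRing.Nmodule_isComNzSemiRing.Build S
  (@smulA G) (@smulC G) (@smul1x G) (smulDl hG)
  (fun x : S => erefl (SZero : S)) sone_neq0.

Lemma saddE (x y : S) : sadd x y = x + y. Proof. by []. Qed.
Lemma smulE (x y : S) : smul x y = x * y. Proof. by []. Qed.
Lemma spowE (x : S) k : spow x k = x ^+ k.
Proof. by elim: k => // k ih; rewrite exprS -ih. Qed.

(** Coefficient lists may end in zeros, which this passage drops; every coefficient is kept. *)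
Definition smx_poly (p : spoly G) : {poly S} := Poly (p : seq S).

Lemma coef_smx_poly p i : (smx_poly p)`_i = scoef p i.
Proof. by rewrite coef_Poly. Qed.

Lemma scoef_default (p : spoly G) i : (size p <= i)%N -> scoef p i = SZero.
Proof. exact: nth_default. Qed.

Lemma smx_poly_add p q : smx_poly (spadd p q) = smx_poly p + smx_poly q.
Proof.
apply/polyP=> i; rewrite coefD !coef_smx_poly {1}/scoef.
have [h|h] := ltnP i (maxn (size p) (size q)); first by rewrite nth_mkseq.
rewrite nth_default ?size_mkseq //; move: h; rewrite geq_max => /andP[h1 h2].
by rewrite !scoef_default.
Qed.

Lemma smx_poly_mul p q : smx_poly (spmul p q) = smx_poly p * smx_poly q.
Proof.
apply/polyP=> i; rewrite coefM !coef_smx_poly {1}/scoef.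
transitivity (\sum_(j < i.+1) ((scoef p j : S) * scoef q (i - j)%N) : S); last first.
  by apply: eq_bigr => j _; rewrite !coef_smx_poly.
have [h|h] := ltnP i (size p + size q).-1; first by rewrite nth_mkseq.
rewrite nth_default ?size_mkseq // big1 // => j _.
have [h1|h1] := leqP (size p) j; first by rewrite scoef_default // mul0r.
rewrite (@scoef_default q) ?mulr0 //.
by move: (ltn_ord j) h h1; move: (size p) (size q) (j : nat) => *; lia.
Qed.

Lemma smx_poly_scale c p : smx_poly (spscale c p) = (c : S) *: smx_poly p.
Proof.
apply/polyP=> i; rewrite coefZ !coef_smx_poly /scoef.
have [h|h] := ltnP i (size p); first by rewrite (nth_map SZero).
by rewrite !nth_default ?size_map // mulr0.
Qed.

Lemma smx_poly_Xsub (r : smax G) : smx_poly (sXsub r) = 'X + (sopp r : S)%:P.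
Proof.
apply/polyP=> i; rewrite coefD coefX coefC coef_smx_poly.
by case: i => [|[|i]] //=; rewrite ?add0r ?addr0 // /scoef /= nth_nil.
Qed.

Lemma speval_horner (p : spoly G) (x : S) : speval p x = (smx_poly p).[x].
Proof.
rewrite (@horner_coef_wide _ (size p)) ?size_Poly //.
by apply: eq_bigr => i _; rewrite coef_smx_poly spowE.
Qed.

End SemiringInstance.

(** * The tropical characteristic polynomial *)

Section Absorption.
Variable R : comNzSemiRingType.
Implicit Types x y z : R.

(** The natural order of an idempotent semiring: [x] disappears from any sum that contains [y]. *)
Definition absorbed x y := x + y = y.

Lemma absorbed_trans x y z : absorbed x y -> absorbed y z -> absorbed x z.
Proof. by rewrite /absorbed => h1 h2; rewrite -h2 addrA h1. Qed.

Lemma absorbed_mull z x y : absorbed x y -> absorbed (z * x) (z * y).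
Proof. by rewrite /absorbed => h; rewrite -mulrDr h. Qed.

Lemma absorbed_mul x y z t :
  absorbed x y -> absorbed z t -> absorbed (x * z) (y * t).
Proof.
move=> h1 h2; apply: (@absorbed_trans _ (x * t)); first exact: absorbed_mull.
by rewrite ![_ * t]mulrC; apply: absorbed_mull.
Qed.

Lemma absorbed_sum (I : Type) (r : seq I) (P : pred I) (F : I -> R) y :
  (forall i, P i -> absorbed (F i) y) -> absorbed (\sum_(i <- r | P i) F i) y.
Proof.
move=> h; apply: (big_ind (fun x => absorbed x y)) => //.
  exact: add0r.
by move=> a b ha hb; rewrite /absorbed -addrA hb ha.
Qed.

Hypothesis addrr : forall x, x + x = x.

Lemma absorbed_prod (I : Type) (r : seq I) (F H : I -> R) :
  (forall i, absorbed (F i) (H i)) ->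
  absorbed (\prod_(i <- r) F i) (\prod_(i <- r) H i).
Proof.
move=> h; elim/big_ind2: _ => [|*|i _]; [exact: addrr|exact: absorbed_mul|exact: h].
Qed.

End Absorption.

Lemma perm_neq1_moves (T : finType) (s : {perm T}) :
  s != 1%g -> exists j, j != s j.
Proof.
move=> s1; apply/existsP; apply: contraR s1; rewrite negb_exists => /forallP h.
by apply/eqP/permP => i; rewrite perm1; apply/esym/eqP; rewrite -[_ == _]negbK.
Qed.

Section TropicalCharpoly.
Variables (G : ordZmodType) (hG : totally_ordered_abelian_group G).
Local Notation S := (smx hG).

(** Reindexing one copy of the sum of [d] along [s] turns its double into the sum of
    [d i + d (s i)], which is compared termwise with the double of the sum of [f]. *)
Lemma og_sum_perm_lt n (s : 'S_n) (f d : 'I_n -> G) (j : 'I_n) :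
  (forall i, f i + f i <= d i + d (s i)) -> f j + f j < d j + d (s j) ->
  \sum_i f i < \sum_i d i.
Proof.
move=> h hj; rewrite -(og_double_lt hG).
rewrite [X in _ < _ + X](reindex_inj (@perm_inj _ s)) -!big_split /=.
by apply: (@og_sum_lt G hG _ _ _ _ j) => //; rewrite mem_index_enum.
Qed.

Lemma smx_addrr (x : S) : x + x = x.
Proof. by case: x => // s a; rewrite -saddE sadd_eq; case: s. Qed.

Lemma smx_poly_addrr (p : {poly S}) : p + p = p.
Proof. by apply/polyP=> i; rewrite coefD smx_addrr. Qed.

Lemma prod_SElt (I : Type) (r : seq I) (x : I -> S) (f : I -> G) :
  (forall i, exists s, x i = SElt s (f i)) ->
  exists s, \prod_(i <- r) x i = SElt s (\sum_(i <- r) f i).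
Proof.
move=> h; apply: (big_ind2 (fun (u : S) a => exists s, u = SElt s a)) => //.
  by exists SPl.
by move=> _ a _ b [s ->] [t ->]; exists (stag_mul s t).
Qed.

Definition smod (x : smax G) : G := if x is SElt _ a then a else 0.

Section TPDMatrix.
Variables (n : nat) (A : 'M[smax G]_n) (hA : TPD A).
Local Notation d := (fun i => smod (A i i)).

Lemma squad_supp2 i j (a b : S) (x : 'I_n -> S) : i != j ->
  x i = a -> x j = b -> (forall k, k != i -> k != j -> x k = 0) ->
  squad A x = a * A i i * a + a * A i j * b + (b * A j i * a + b * A j j * b) :> S.
Proof.
move=> ij xi xj xk.
have sum2 (F : 'I_n -> S) : (forall k, k != i -> k != j -> F k = 0) ->
    \sum_k F k = F i + F j.
  move=> h; rewrite (bigD1 i) //= (bigD1 j) 1?eq_sym //= big1 ?addr0 //.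
  by move=> k /andP[]; apply: h.
have -> : squad A x = (\sum_k \sum_l (x k * (A k l : S) * x l) : S) by [].
rewrite sum2; last by move=> k ki kj; rewrite big1 // => l _; rewrite xk // !mul0r.
by rewrite !sum2 ?xi ?xj // => k ki kj; rewrite xk // mulr0.
Qed.

(** The test vector is the unit vector of index [i]. *)
Lemma TPD_diag i : A i i = SElt SPl (smod (A i i)).
Proof.
have [_ [_ /(_ (fun k => if k == i then sone G else SZero))]] := hA.
have -> : squad A (fun k => if k == i then sone G else SZero) = A i i.
  pose x k : S := if k == i then 1 else 0.
  transitivity (\sum_k \sum_l (x k * (A k l : S) * x l) : S) => //.
  have xk k : k != i -> x k = 0 by rewrite /x => /negPf->.
  rewrite (bigD1 i) //= [X in _ + X]big1 ?addr0 => [|k /xk->]; last first.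
    by rewrite big1 // => l _; rewrite !mul0r.
  rewrite (bigD1 i) //= big1 ?addr0 => [|k /xk->]; last by rewrite mulr0.
  by rewrite /x eqxx mul1r mulr1.
case: (A i i) => [|[] a] //= h.
all: have : false by apply: h => [k|]; [case: ifP|exists i; rewrite eqxx].
all: by [].
Qed.

Lemma TPD_offdiag i j s a : i != j -> A i j = SElt s a -> a + a < d i + d j.
Proof.
move=> ij hij; have [hs [hsig hpos]] := hA.
have hji : A j i = SElt s a by rewrite -hij -{1}hs mxE.
pose x k : smax G := if k == i then sopp (A i j) else if k == j then A i i else SZero.
have ss : ssigned (SElt s a) by rewrite -hij hsig.
have xs k : ssigned (x k).
  by rewrite /x hij; case: ifP => _; [case: (s) ss|case: ifP => _; rewrite ?hsig].
have xn : exists k, x k <> SZero by exists i; rewrite /x eqxx hij; case: (s).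
have := hpos x xs xn.
rewrite (@squad_supp2 i j (sopp (A i j)) (A i i) x ij) /x ?eqxx //; first last.
- by move=> k /negPf-> /negPf->.
- by rewrite eq_sym (negPf ij).
rewrite /slt /ssub (saddC hG) sadd0x (TPD_diag i) (TPD_diag j) hji hij.
set u := smod (A i i); set w := smod (A j j).
have -> : sopp (SElt s a) = SElt (stag_mul SMi s) a by case: (s).
rewrite -!saddE -!smulE /smul.
have -> : stag_mul (stag_mul (stag_mul SMi s) SPl) (stag_mul SMi s) = SPl by case: (s) ss.
have -> : stag_mul (stag_mul (stag_mul SMi s) s) SPl = SMi by case: (s) ss.
have -> : stag_mul (stag_mul SPl s) (stag_mul SMi s) = SMi by case: (s) ss.
have -> : a + u + a = u + (a + a) by rewrite addrCA addrA.
have -> : a + a + u = u + (a + a) by rewrite addrC.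
have -> : u + a + a = u + (a + a) by rewrite addrA.
have -> : u + w + u = u + (u + w) by rewrite addrC.
rewrite sadd_eq (saddA hG) sadd_eq.
(* The three terms of modulus [u + (a + a)] have both signs and add up to a balanced element.
   Positivity of the form therefore leaves only the case where [u + (u + w)] is strictly larger. *)
case: (comparable_ltgtP (og_cmp hG (u + (a + a)) (u + (u + w)))) => [|h|->].
- by rewrite (og_ltD2l hG).
- by rewrite sadd_gt.
by rewrite sadd_eq.
Qed.

Local Notation D i := ('X + (sopp (A i i) : S)%:P).

Lemma smx_poly_scharpoly : smx_poly hG (scharpoly A) =
  \sum_(s : 'S_n) (spsign G s : S) *: \prod_i
     (if i == s i then 'X + (sopp (A i (s i)) : S)%:P
      else (sopp (A i (s i)) : S)%:P).
Proof.
rewrite /scharpoly (big_morph _ (@smx_poly_add G hG) (erefl : smx_poly hG [::] = 0)).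
apply: eq_bigr => s _; rewrite smx_poly_scale; congr (_ *: _).
have one : smx_poly hG [:: sone G] = 1 by rewrite /smx_poly /= cons_poly_def mul0r add0r.
rewrite (big_morph _ (@smx_poly_mul G hG) one); apply: eq_bigr => i _.
case: ifP => _; first by rewrite smx_poly_Xsub.
by rewrite /smx_poly /= cons_poly_def mul0r add0r.
Qed.

(** Fixed points of [s] contribute the same factor to both expansions, so they are replaced by 1. On
    the moved indices [TPD_offdiag] makes the diagonal product strictly larger in modulus, whatever
    the signs. *)
Lemma perm_term_absorbed (s : 'S_n) : s != 1%g ->
  absorbed ((spsign G s : S) * \prod_i (if i == s i then 1 else (sopp (A i (s i)) : S)))
           (\prod_i (if i == s i then 1 else (sopp (A i i) : S))).
Proof.
move=> s1; have [j hj] := perm_neq1_moves s1.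
have fixs i : (s i == s (s i)) = (i == s i) by rewrite (inj_eq perm_inj).
have [[i /andP[ij /eqP Aij]]|nz] :=
  altP (@existsP _ (fun i => (i != s i) && (A i (s i) == SZero))).
  by rewrite /absorbed (bigD1 i) //= (negPf ij) Aij mul0r mulr0 add0r.
set b := \prod_i _; set c := \prod_i _.
(* The value 0 is the modulus of the factor 1 placed at fixed points. *)
pose f i := if i == s i then 0 else smod (A i (s i)).
pose g i := if i == s i then 0 else smod (A i i).
have [r hb] : exists r, b = SElt r (\sum_i f i).
  apply: prod_SElt => i; rewrite /f; case: ifP => [_|/negbT ij]; first by exists SPl.
  move/existsPn/(_ i): nz; rewrite ij /=.
  by case: (A i (s i)) => [|[] a] // _; [exists SMi|exists SPl|exists SBa].
have [t hc] : exists t, c = SElt t (\sum_i g i).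
  apply: prod_SElt => i; rewrite /g; case: ifP => [_|/negbT ij]; first by exists SPl.
  by rewrite TPD_diag /=; exists SMi.
have fg : \sum_i f i < \sum_i g i.
  have fg0 i : i != s i -> f i + f i < g i + g (s i).
    move=> ij; rewrite /f /g fixs (negPf ij).
    case e : (A i (s i)) => [|u a]; last exact: TPD_offdiag e.
    by move/existsPn/(_ i): nz; rewrite ij e.
  apply: (@og_sum_perm_lt _ s _ _ j); last exact: fg0.
  move=> i; have [ij|/fg0/ltW//] := boolP (i == s i).
  by rewrite /f /g fixs ij.
rewrite hb hc; have -> : (spsign G s : S) = SElt (if odd_perm s then SMi else SPl) 0.
  by rewrite /spsign; case: (odd_perm s).
by rewrite /absorbed -smulE -saddE /smul add0r sadd_lt.
Qed.

Lemma smx_poly_scharpolyE : smx_poly hG (scharpoly A) = \prod_i D i.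
Proof.
rewrite smx_poly_scharpoly (bigD1 1%g) //=.
have -> : (spsign G (1%g : 'S_n) : S) = 1 by rewrite /spsign odd_perm1.
rewrite scale1r (eq_bigr (fun i => D i)) => [|i _]; last by rewrite perm1 eqxx.
rewrite addrC; apply: absorbed_sum => s s1.
pose F i : {poly S} := if i == s i then D i else 1.
(* Two absorptions: the off-diagonal entries by the diagonal ones, then each constant [⊖ a_ii] by
   [X ⊖ a_ii], of which it is a term. *)
apply: (@absorbed_trans _ _ (\prod_i (F i * (if i == s i then 1 else (sopp (A i i) : S))%:P))).
  rewrite (eq_bigr (fun i => F i * (if i == s i then 1 else (sopp (A i (s i)) : S))%:P)).
    rewrite !big_split /= -!rmorph_prod -mul_polyC mulrCA -rmorphM.
    apply: absorbed_mull; rewrite /absorbed -rmorphD; congr polyC.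
    exact: perm_term_absorbed.
  move=> i _; rewrite /F; case: eqP => [<-|_]; last by rewrite mul1r.
  by rewrite polyC1 mulr1.
apply: absorbed_prod => [|i]; first exact: smx_poly_addrr.
rewrite /F; case: ifP => _; first by rewrite polyC1 mulr1 /absorbed smx_poly_addrr.
by rewrite mul1r /absorbed addrCA smx_poly_addrr.
Qed.

Lemma sdet_sshift (g : S) : sdet (sshift g A) = \prod_i (g + (sopp (A i i) : S)) :> S.
Proof.
(* The Leibniz expansion of the determinant is the value at [g] of that of the characteristic
   polynomial, so the factorization carries over. *)
rewrite (_ : \prod_i _ = (smx_poly hG (scharpoly A)).[g]); last first.
  rewrite smx_poly_scharpolyE horner_prod; apply: eq_bigr => i _.
  by rewrite hornerD hornerX hornerC.
rewrite smx_poly_scharpoly horner_sum; apply: eq_bigr => s _.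
rewrite hornerZ horner_prod; congr (_ * _); apply: eq_bigr => i _.
rewrite mxE; case: ifP => _; last by rewrite hornerC /ssub sadd0x.
by rewrite hornerD hornerX hornerC.
Qed.

End TPDMatrix.
End TropicalCharpoly.

(** * Multiplicities *)

Section Multiplicity.
Variables (G : ordZmodType) (hG : totally_ordered_abelian_group G).
Local Notation S := (smx hG).
Local Notation cmp x y := (comparable_ltgtP (og_cmp hG x y)).
Implicit Types (x y z : S) (M : G).

Definition level_le x M : bool := if x is SElt _ a then a <= M else true.
Definition level_lt x M : bool := if x is SElt _ a then a < M else true.

Lemma level_le_add x y M : level_le (x + y) M = level_le x M && level_le y M.
Proof.
rewrite -saddE; case: x y => [|s a] [|t b] //=; first by rewrite andbT.
case: (cmp a b) => [ab|ba|->] /=; last by rewrite andbb.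
  by apply/idP/andP => [h|[]//]; split=> //; apply: le_trans h; apply: ltW.
by apply/idP/andP => [h|[]//]; split=> //; apply: le_trans h; apply: ltW.
Qed.

Lemma level_lt_add x y M : level_lt (x + y) M = level_lt x M && level_lt y M.
Proof.
rewrite -saddE; case: x y => [|s a] [|t b] //=; first by rewrite andbT.
case: (cmp a b) => [ab|ba|->] /=; last by rewrite andbb.
  by apply/idP/andP => [h|[]//]; split=> //; apply: lt_trans h.
by apply/idP/andP => [h|[]//]; split=> //; apply: lt_trans h.
Qed.

Lemma level_le_mul s a x M : level_le ((SElt s a : S) * x) (a + M) = level_le x M.
Proof. by case: x => //= t b; rewrite og_leD2l. Qed.

Lemma level_lt_mul s a x M : level_lt ((SElt s a : S) * x) (a + M) = level_lt x M.
Proof. by case: x => //= t b; rewrite og_ltD2l. Qed.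

Lemma level_le_lt_trans x M N : level_le x M -> M < N -> level_lt x N.
Proof. by case: x => //= s a; apply: le_lt_trans. Qed.

Lemma level_ltW x M : level_lt x M -> level_le x M.
Proof. by case: x => //= s a; apply: ltW. Qed.

Definition rootpoly (s : seq G) : {poly S} :=
  \prod_(c <- s) ('X + (SElt SMi c : S)%:P).

Lemma coef_XaddC_mul (c : S) (p : {poly S}) i :
  (('X + c%:P) * p)`_i = (if i is j.+1 then p`_j else 0) + c * p`_i.
Proof. by rewrite mulrDl coefD coefXM coefCM; case: i. Qed.

(** The sign of the coefficient of degree [i] is governed by the parity of [size s + i]. Only terms
    of equal sign are ever added, so no balanced element appears. *)
Lemma rootpoly_signed s i : ssigned ((rootpoly s)`_i).
Proof.
pose alt (N : nat) x := x = 0 \/ exists a, x = SElt (if odd N then SMi else SPl) a.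
suff : alt (size s + i)%N (rootpoly s)`_i.
  by case=> [->//|[a ->]]; case: ifP.
have altD N x y : alt N x -> alt N y -> alt N (x + y).
  case=> [->|[a ->]]; first by rewrite add0r.
  case=> [->|[b ->]]; first by rewrite addr0; right; exists a.
  right; rewrite -saddE /=; case: (cmp a b) => [_|_|->]; [by exists b|by exists a|].
  by exists b; case: ifP.
elim: s i => [|c s ih] i.
  rewrite /rootpoly big_nil coef1 addnC addn0.
  by case: i => [|i] /=; [right; exists 0|left].
rewrite /rootpoly big_cons coef_XaddC_mul; apply: altD.
  by case: i => [|i]; [left|rewrite /= addnS /=; move: (ih i); rewrite /alt /= negbK].
case: (ih i) => [->|[a ->]]; first by left; rewrite mulr0.
by right; exists (c + a); rewrite -smulE /=; case: (odd _).
Qed.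

Lemma sbalanced_prod (s : seq G) x : ssigned x ->
  sbalanced (\prod_(c <- s) (x + (SElt SMi c : S)))
  = has (fun c => SElt SPl c == x :> smax G) s.
Proof.
move=> hx; elim: s => [|c s ih]; first by rewrite big_nil.
rewrite big_cons -smulE sbalanced_mul ih /=; congr (_ || _).
rewrite -saddE; case: x hx {ih} => [|[] a] //= _; first last.
- by case: (cmp a c) => //.
case: (cmp a c) => [h|h|->] /=; rewrite ?eqxx //; symmetry; apply/eqP => -[e].
  by rewrite e ltxx in h.
by rewrite e ltxx in h.
Qed.

Lemma rootpoly_horner s x : (rootpoly s).[x] = \prod_(c <- s) (x + (SElt SMi c : S)).
Proof.
by rewrite horner_prod; apply: eq_bigr => c _; rewrite hornerD hornerX hornerC.
Qed.

Lemma snabla_signed_eq x y : ssigned x -> ssigned y -> snabla x y -> x = y.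
Proof.
rewrite /snabla /ssub; case: x y => [|[] a] [|[] b] //= _ _; case: (cmp a b) => //.
all: by move=> ->.
Qed.

(** If [x] had larger modulus than [y], then [x ⊖ y] would be [x], which is signed and nonzero. *)
Lemma snabla_level_le x y M : ssigned x -> snabla x y -> level_le y M -> level_le x M.
Proof.
rewrite /snabla /ssub; case: x y => [|[] a] [|[] b] //= _; case: (cmp a b) => //.
all: by move=> h; rewrite ?h // => _; apply: le_trans; rewrite ltW.
Qed.

Lemma snabla_mul x y z : snabla x y -> snabla (x * z) (y * z).
Proof.
rewrite /snabla /ssub -!smulE sopp_mul -(smulDl hG) sbalanced_mul => ->.
by [].
Qed.

(** [None] stands for zero, for a modulus other than [M], and for balanced elements. *)
Definition sgn_at M x : option bool :=
  if x is SElt s a then if a == M then stag_enc s else None else None.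

Lemma sgn_at_Some M x b : sgn_at M x = Some b -> x = SElt (stag_dec (Some b)) M.
Proof. by case: x => //= s a; case: eqP => // -> h; rewrite -[in LHS](stag_encK s) h. Qed.

Lemma sgn_at_opp M x : sgn_at M (sopp x) = omap negb (sgn_at M x).
Proof. by case: x => [|[] a] //=; case: eqP. Qed.

Lemma soppK x : sopp (sopp x) = x.
Proof. by case: x => [|[] a]. Qed.

Lemma level_le_opp x M : level_le (sopp x) M = level_le x M.
Proof. by case: x => [|[] a]. Qed.

Lemma ssigned_opp x : ssigned (sopp x) = ssigned x.
Proof. by case: x => [|[] a]. Qed.

Lemma sgn_at_mul a M x : sgn_at (a + M) ((SElt SPl a : S) * x) = sgn_at M x.
Proof. by case: x => [|[] b] //=; rewrite (inj_eq (addrI a)). Qed.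

(** Either [y] has smaller modulus, or [⊖ y] has the modulus and the sign of [x]; in both cases [x]
    absorbs it. *)
Lemma ssub_dominant M x y b :
  level_le y M -> sgn_at M x = Some b -> sgn_at M y <> Some b -> ssigned y ->
  ssub x y = x.
Proof.
move=> hy /sgn_at_Some ->; case: y hy => //= t a; rewrite le_eqVlt.
case: eqP => [->|_] /= h; first by case: b t {h} => [] [] //= h _; rewrite /ssub /= ?ltxx.
by move=> _ _; rewrite /ssub; case: t => /=; rewrite h lt_gtF.
Qed.

(** * Terms of maximal modulus at a positive root *)

Section Root.
Variable rho : G.
Local Notation r := (SElt SPl rho : S).

(** The terms of the value of [p] at [r]. Those of maximal modulus are the points of the Newton
    polygon on the supporting line attached to [r]. *)
Definition weight (p : {poly S}) i : S := p`_i * r ^+ i.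

Lemma weight_XaddC_mul (c : S) p i :
  weight (('X + c%:P) * p) i =
  (if i is j.+1 then r * weight p j else 0) + c * weight p i.
Proof.
rewrite /weight coef_XaddC_mul mulrDl mulrA; congr (_ + _).
by case: i => [|i]; rewrite ?mul0r // exprS mulrCA.
Qed.

(** Induction on the factors [X ⊖ c]. For [c < rho] the window of maximal terms shifts by one, for
    [c > rho] it stays, and for [c = rho] it is joined with its shift and grows by one index. *)
Lemma rootpoly_level s : exists a M,
  [/\ forall i, level_le (weight (rootpoly s) i) M,
      exists i, ~~ level_lt (weight (rootpoly s) i) M
    & forall i, ~~ level_lt (weight (rootpoly s) i) M ->
        (a <= i <= a + count_mem rho s)%N].
Proof.
elim: s => [|c s [a [M [h1 [i0 h2] h3]]]].
  have w i : weight (rootpoly [::]) i = if i is _.+1 then 0 else 1.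
    by rewrite /weight /rootpoly big_nil coef1; case: i => [|i]; rewrite ?mul0r ?mulr1.
  exists 0%N, 0; split; first by case=> [|i]; rewrite w /= ?lexx.
    by exists 0%N; rewrite w /= ltxx.
  by case=> [|i]; rewrite w.
have rpE : rootpoly (c :: s) = ('X + (SElt SMi c : S)%:P) * rootpoly s.
  by rewrite /rootpoly big_cons.
rewrite rpE; set w := weight (rootpoly s) in h1 h2 h3.
have wE i : weight (('X + (SElt SMi c : S)%:P) * rootpoly s) i =
  (if i is j.+1 then r * w j else 0) + (SElt SMi c : S) * w i.
  exact: weight_XaddC_mul.
case: (cmp c rho) => [lt|lt|eq].
- exists a.+1, (rho + M); have hlt i : level_lt ((SElt SMi c : S) * w i) (rho + M).
    by apply: (@level_le_lt_trans _ (c + M)); rewrite ?level_le_mul ?og_ltD2r.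
  rewrite /= (lt_eqF lt) add0n; split=> [i||i].
  + rewrite wE level_le_add (level_ltW (hlt i)) andbT.
    by case: i => // i; rewrite level_le_mul.
  + by exists i0.+1; rewrite wE level_lt_add level_lt_mul (negPf h2).
  rewrite wE level_lt_add hlt andbT; case: i => // i.
  by rewrite level_lt_mul => /h3; rewrite addSn !ltnS.
- exists a, (c + M).
  have hlt i : level_lt (if i is j.+1 then r * w j else 0) (c + M).
    by case: i => // i; apply: (@level_le_lt_trans _ (rho + M)); rewrite ?level_le_mul ?og_ltD2r.
  rewrite /= (gt_eqF lt) add0n; split=> [i||i].
  + by rewrite wE level_le_add (level_ltW (hlt i)) level_le_mul h1.
  + by exists i0; rewrite wE level_lt_add level_lt_mul (negPf h2) andbF.
  by rewrite wE level_lt_add hlt level_lt_mul => /h3.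
rewrite {}eq in rpE wE *; exists a, (rho + M).
rewrite /= eqxx add1n addnS; move: (count _ _) h3 => m h3; split=> [i||i].
- by rewrite wE level_le_add level_le_mul h1 andbT; case: i => // i; rewrite level_le_mul.
- by exists i0; rewrite wE level_lt_add level_lt_mul (negPf h2) andbF.
rewrite wE level_lt_add level_lt_mul negb_and => /orP[|/h3]; last by lia.
by case: i => // i; rewrite level_lt_mul => /h3; lia.
Qed.

(** A chain of [k] alternating signs amounts to [k - 1] sign changes in the sense of Descartes;
    [None] entries are skipped. *)
Fixpoint sign_chain (f : nat -> option bool) k b i : Prop :=
  if k is k'.+1 then
    exists j, [/\ (i <= j)%N, f j = Some b & sign_chain f k' (~~ b) j.+1]
  else True.

Lemma sign_chain_leq f k b i i' :
  (i' <= i)%N -> sign_chain f k b i -> sign_chain f k b i'.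
Proof.
case: k => //= k le [j [ij fj c]]; exists j; split=> //; exact: leq_trans ij.
Qed.

(** The first window index still available is [maxn i a], so the bound counts the remaining ones. *)
Lemma sign_chain_size f a m k b i :
  (forall j, f j <> None -> (a <= j <= a + m)%N) ->
  sign_chain f k b i -> (k <= (a + m).+1 - maxn i a)%N.
Proof.
move=> h; elim: k b i => //= k ih b i [j [ij fj /ih]].
by have : f j <> None by [rewrite fj]; move/h; lia.
Qed.

(* Descartes' rule of signs over the hyperfield of signs: the hypotheses say
   that g is the sign pattern of (X - 1) * f, undetermined where the two
   contributing signs of f cancel. *)
Lemma sign_chain_Xsub (f g : nat -> option bool) k b N :
  (forall i, (N <= i)%N -> f i = None) ->
  (forall i b, f i = Some b -> f i.+1 <> Some b -> g i.+1 = Some b) ->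
  (forall i b, f i = Some b -> (if i is j.+1 then f j else None) <> Some b ->
     g i = Some (~~ b)) ->
  sign_chain f k.+1 b 0 -> sign_chain g k.+2 (~~ b) 0.
Proof.
move=> hN hr hl.
(* Going from [i] to [j], [f] must leave the value [c]; the index just after the last [c] before [j]
   has sign [c] in [g]. *)
have step i j c : (i <= j)%N -> f i = Some c -> f j <> Some c ->
    exists l, [/\ (i < l <= j)%N & g l = Some c].
  move=> ij fi; elim: j ij => [|j ih].
    by rewrite leqn0 => /eqP<-; rewrite fi.
  rewrite leq_eqVlt => /orP[/eqP<-|]; first by rewrite fi.
  rewrite ltnS => ij fj; have [fjc|/eqP fjc] := eqVneq (f j) (Some c).
    by exists j.+1; split; [lia|apply: hr fjc fj].
  by have [l [hl1 hl2]] := ih ij fjc; exists l; split=> //; lia.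
(* Each sign of the chain moves right, at most to the index of the next one. The last sign survives
   because [f] is [None] from [N] on. *)
have right_chain : forall k' c i, f i = Some c -> sign_chain f k' (~~ c) i.+1 ->
    sign_chain g k'.+1 c i.+1.
  elim=> [|k' ih] c i fi /=.
    have [|l [hl1 hl2]] := @step i (maxn N i) c (leq_maxr _ _) fi.
      by rewrite hN ?leq_maxl.
    by exists l; split=> //; lia.
  case=> j [ij fj cj]; have [||l [hl1 hl2]] := @step i j c _ fi; first by lia.
    by rewrite fj; case: (c).
  exists l; split=> //; first by lia.
  by apply: sign_chain_leq (ih _ _ fj cj); lia.
case=> i [_ fi ci].
(* The additional sign: at the left end of the run of [b] reaching [i], [g] has the opposite
   sign. *)
have [l [li hgl]] : exists l, (l <= i)%N /\ g l = Some (~~ b).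
  suff aux j : (j <= i)%N -> f j = Some b ->
      exists l, (l <= i)%N /\ g l = Some (~~ b) by apply: aux fi.
  elim: j => [|j ih] ji fj; first by exists 0%N; split=> //; apply: hl fj _.
  have [fjb|/eqP fjb] := eqVneq (f j) (Some b); first by apply: ih => //; lia.
  by exists j.+1; split=> //; apply: hl fj _.
exists l; split=> //; rewrite negbK; apply: sign_chain_leq (right_chain k _ _ fi ci).
by rewrite ltnS.
Qed.


Lemma signed_level_max (I : finType) (f : I -> S) : (forall i, ssigned (f i)) ->
  (exists i, f i <> 0) ->
  exists M b i, sgn_at M (f i) = Some b /\ forall j, level_le (f j) M.
Proof.
move=> hs [i0 fi0].
pose l := [seq smod (f i) | i <- enum I & f i != 0].
have lP i : f i <> 0 -> smod (f i) \in l.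
  by move=> /eqP h; apply: map_f; rewrite mem_filter h mem_enum.
have [|M Ml hM] := og_has_max hG (s := l).
  by apply/eqP => l0; have := lP _ fi0; rewrite l0.
have /mapP[k] := Ml; rewrite mem_filter => /andP[/eqP fk _] eM.
exists M, (if f k is SElt SPl _ then true else false), k; split.
  by rewrite eM; move: (hs k) fk; case: (f k) => [|[] a] //= _ _; rewrite eqxx.
by move=> j; have := @lP j; case: (f j) => // s a /(_ _)/hM; apply.
Qed.

(** Without a term of opposite sign at level [M], every partial sum would be below [M] or equal to
    the signed element of modulus [M] and sign [b], so the total would be signed and nonzero. *)
Lemma balanced_sum_signs (I : finType) (f : I -> S) M b i :
  (forall j, ssigned (f j)) -> (forall j, level_le (f j) M) ->
  sgn_at M (f i) = Some b -> sbalanced (\sum_j f j : S) ->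
  exists j, sgn_at M (f j) = Some (~~ b).
Proof.
move=> hs hM fi bal.
have [/existsP[j /eqP hj]|no] := boolP [exists j, sgn_at M (f j) == Some (~~ b)].
  by exists j.
pose Q x := level_lt x M \/ x = SElt (stag_dec (Some b)) M.
have hQ : Q (\sum_j f j).
  apply: (big_ind Q) => [|x y|j _]; first by left.
    case=> [hx|->] [hy|->].
    - by left; rewrite level_lt_add hx.
    - by right; case: x hx => //= s a h; rewrite -saddE sadd_lt.
    - by right; case: y hy => //= s a h; rewrite -saddE sadd_gt.
    by right; rewrite -saddE sadd_eq; case: (b).
  move/existsPn: no => /(_ j); move: (hs j) (hM j); case: (f j) => [|s a] //=.
    by left.
  rewrite le_eqVlt; case: eqP => [->|_] /= hsa; last by left.
  by rewrite /Q; case: s hsa => //; case: (b) => // _ _ _; right.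
move: bal; case: hQ => [|->]; last by case: (b).
rewrite (bigD1 i) //= level_lt_add (sgn_at_Some fi) /=.
by rewrite ltxx.
Qed.

Lemma spow_pos i : spow r i = SElt SPl (rho *+ i).
Proof. by elim: i => // i /= ->; rewrite mulrS. Qed.

Lemma weight_signed p i : (forall i, ssigned (scoef p i)) ->
  ssigned (weight (smx_poly hG p) i).
Proof.
move=> /(_ i); rewrite /weight coef_smx_poly -spowE spow_pos.
by case: (scoef p i) => [|[] b].
Qed.

(** Induction on the multiplicity. At a root the terms of maximal modulus take both signs, which
    gives a chain of two; each factor [X ⊖ r] lengthens it by one through [sign_chain_Xsub]. *)
Lemma smult_ge_chain k (p : spoly G) : (forall i, ssigned (scoef p i)) ->
  (exists i, scoef p i <> SZero) -> smult_ge k.+1 p r ->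
  exists M b, (forall i, level_le (weight (smx_poly hG p) i) M) /\
    sign_chain (fun i => sgn_at M (weight (smx_poly hG p) i)) k.+2 b 0.
Proof.
elim: k p => [|k ih] p hs [i0 pi0].
  case=> bal _.
  have sz i : (size p <= i)%N -> weight (smx_poly hG p) i = 0.
    by move=> h; rewrite /weight coef_smx_poly scoef_default ?mul0r.
  pose f (i : 'I_(size p)) := weight (smx_poly hG p) i.
  have sum_f : speval p r = \sum_i f i.
    rewrite (@speval_horner G hG) (@horner_coef_wide _ (size p)) ?size_Poly //.
  have fnz : exists i, f i <> 0.
    have lt : (i0 < size p)%N by rewrite ltnNge; apply/negP => /scoef_default.
    exists (Ordinal lt); rewrite /f /weight coef_smx_poly -spowE spow_pos /=.
    by case: (scoef p i0) pi0.
  have fs i : ssigned (f i) by apply: weight_signed.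
  have [M [b [i [hi hM]]]] := signed_level_max fs fnz.
  rewrite sum_f in bal; have [j hj] := balanced_sum_signs fs hM hi bal.
  exists M; have ij : (i : nat) <> j by move/val_inj => e; move: hj; rewrite -e hi; case: (b).
  have hM' l : level_le (weight (smx_poly hG p) l) M.
    by have [h|h] := ltnP l (size p); [exact: (hM (Ordinal h))|rewrite sz].
  have [lt|lt|//] := ltngtP i j; [exists b|exists (~~ b)]; split=> //=.
    by exists i; split=> //; exists j.
  by exists j; split=> //; exists i; rewrite negbK.
case=> _ [//|[q [/all_nthP qs' [nab mq]]]].
have qs i : ssigned (scoef q i).
  by have [h|h] := ltnP i (size q); [exact: qs'|rewrite scoef_default].
(* If [q] were zero, the signed nonzero coefficient of [p] at [i0] would be balanced. *)
have qnz : exists i, scoef q i <> SZero.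
  have [/existsP[i /eqP h]|no] := boolP [exists i : 'I_(size q), scoef q i != SZero].
    by exists i.
  have q0 : smx_poly hG q = 0.
    apply/polyP => i; rewrite coef_smx_poly coef0.
    have [h|/scoef_default->//] := ltnP i (size q).
    by move/existsPn: no => /(_ (Ordinal h))/negPn/eqP.
  have := nab i0; rewrite -[scoef (spmul _ _) _](@coef_smx_poly G hG).
  rewrite smx_poly_mul q0 mulr0 coef0 (snablax0 hG).
  by move: (hs i0) pi0; case: (scoef p i0) => [|[]].
have [M [b [hM ch]]] := ih q qs qnz mq.
set wp := weight (smx_poly hG p); set wq := weight (smx_poly hG q) in hM ch.
have wqs i : ssigned (wq i) by apply: weight_signed.
have wps i : ssigned (wp i) by apply: weight_signed.
(* The weights of [X q] and [r q]; their difference is the weight of [(X ⊖ r) q]. *)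
pose y i : S := if i is j.+1 then r * wq j else 0.
pose z i : S := r * wq i.
have wnab i : snabla (wp i) (ssub (y i) (z i)).
  have -> : ssub (y i) (z i) = weight (smx_poly hG (spmul (sXsub r) q)) i.
    rewrite smx_poly_mul smx_poly_Xsub weight_XaddC_mul /ssub -/wq.
    by rewrite sopp_mul.
  by apply: snabla_mul; rewrite !coef_smx_poly.
have ymax i : level_le (y i) (rho + M) by case: i => //= i; rewrite level_le_mul.
have zmax i : level_le (z i) (rho + M) by rewrite level_le_mul.
have zs i : ssigned (z i) by rewrite /z; case: (wq i) (wqs i) => [|[]].
have ys i : ssigned (y i) by case: i => //= i; apply: zs.
exists (rho + M), (~~ b); split.
  move=> i; apply: snabla_level_le (wnab i) _ => //.
  by rewrite /ssub saddE level_le_add ymax level_le_opp zmax.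
apply: (sign_chain_Xsub (N := size q)) ch => [i h|i c h1 h2|i c h1 h2].
- by rewrite /wq /weight coef_smx_poly scoef_default // mul0r.
- have := wnab i.+1; rewrite (@ssub_dominant (rho + M) _ _ c) ?sgn_at_mul //.
  by move/(snabla_signed_eq (wps _) (ys i.+1)) => ->; rewrite /y sgn_at_mul.
(* Here [y i ⊖ z i] is read as [⊖ z i] minus [⊖ y i], so that the dominant term comes first, with
   sign [~~ c]. *)
have := wnab i; rewrite /ssub (saddC hG) -[y i]soppK -/(ssub _ _).
rewrite (@ssub_dominant (rho + M) _ _ (~~ c)).
- move/(snabla_signed_eq (wps _)) => ->; rewrite ?ssigned_opp //.
  by rewrite sgn_at_opp sgn_at_mul h1.
- by rewrite level_le_opp.
- by rewrite sgn_at_opp sgn_at_mul h1.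
- rewrite sgn_at_opp; move: h2; case: (i) => [|j] //=; rewrite sgn_at_mul.
  by case: (sgn_at _ _) => // -[]; case: (c).
by rewrite ssigned_opp.
Qed.

Lemma smult_ge_rootpoly k s (p : spoly G) :
  smx_poly hG p = rootpoly s -> (k <= count_mem rho s)%N -> smult_ge k p r.
Proof.
elim: k s p => //= k ih s p hp hk.
have rs : rho \in s by rewrite -has_pred1 has_count; apply: leq_trans hk.
have sE : perm_eq s (rho :: rem rho s) by apply: perm_to_rem.
split.
  rewrite (@speval_horner G hG) hp rootpoly_horner sbalanced_prod //.
  by apply/hasP; exists rho.
(* The cofactor is the product with one occurrence of [rho] removed. *)
right; exists (polyseq (rootpoly (rem rho s)) : seq S); split.
  by apply/(all_nthP SZero) => i _; apply: rootpoly_signed.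
have qE : smx_poly hG (polyseq (rootpoly (rem rho s)) : seq S) = rootpoly (rem rho s).
  exact: polyseqK.
split; last first.
  apply: (ih (rem rho s)) => //.
  by have /= e := seq.permP sE (pred1 rho); move: hk; rewrite e eqxx ltnS.
move=> i; rewrite -!(@coef_smx_poly G hG) smx_poly_mul smx_poly_Xsub qE hp.
by rewrite /rootpoly (perm_big _ sE) big_cons; apply: snabla_refl.
Qed.

(** Multiplicity [k > 0] requires a chain of [k + 1] signs, while [rootpoly_level] leaves only
    [count_mem rho s + 1] indices for the maximal terms. *)
Lemma smult_ge_rootpoly_count k s (p : spoly G) :
  smx_poly hG p = rootpoly s -> smult_ge k p r -> (k <= count_mem rho s)%N.
Proof.
case: k => // k hp hk; have [a [M0 [hle [i0 hi0] hint]]] := rootpoly_level s.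
have ps i : ssigned (scoef p i) by rewrite -(@coef_smx_poly G hG) hp rootpoly_signed.
have [|M [b [hM ch]]] := smult_ge_chain ps _ hk.
  exists i0 => pi0; move: hi0.
  by rewrite -hp /weight coef_smx_poly pi0 mul0r.
rewrite hp in hM ch.
(* The weight at [i0] is at least [M0] and at most [M], so a term of level [M] also reaches [M0] and
   lies in the window. *)
have lv j : sgn_at M (weight (rootpoly s) j) <> None ->
    (a <= j <= a + count_mem rho s)%N.
  move=> hj; apply: hint; move: (hM i0) hi0 hj.
  case: (weight _ i0) => //= t c cM M0c; case: (weight _ j) => //= u e.
  by case: eqP => // -> _; apply: contra M0c => /(le_lt_trans cM).
by have := sign_chain_size lv ch; lia.
Qed.

End Root.

Lemma smult_rootpoly s (p : spoly G) x : smx_poly hG p = rootpoly s -> ssigned x ->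
  smult p x (count (fun c => SElt SPl c == x :> smax G) s).
Proof.
move=> hp hx; have [[rho xE]|npos] : (exists rho, x = SElt SPl rho) \/ ~~ spos_nz x.
  by case: x hx => [|[] rho]; [right|left; exists rho|right|right].
  have -> : count (fun c => SElt SPl c == x :> smax G) s = count_mem rho s.
    by apply: eq_count => c; rewrite xE; apply/eqP/eqP => [[]|->].
  rewrite xE; split; first exact: smult_ge_rootpoly hp _.
  by move/(smult_ge_rootpoly_count hp); rewrite ltnn.
(* A signed [x] that is zero or negative is no root of a product of factors [X ⊖ c]: multiplicity
   and count both vanish. *)
have no : ~~ has (fun c => SElt SPl c == x :> smax G) s.
  by apply/hasPn => c _; apply: contra npos => /eqP<-.
have -> : count (fun c => SElt SPl c == x :> smax G) s = 0%N.
  by apply/eqP; rewrite -leqn0 leqNgt -has_count.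
split=> //= -[]; rewrite (@speval_horner G hG) hp rootpoly_horner sbalanced_prod //.
by rewrite (negPf no).
Qed.

End Multiplicity.

(** * Eigenvalues over the valued field *)

Lemma char_poly_conj (F : fieldType) n (P D : 'M[F]_n) : P \in unitmx ->
  char_poly (invmx P *m D *m P) = char_poly D.
Proof.
move=> uP; rewrite /char_poly.
have -> : char_poly_mx (invmx P *m D *m P) =
    map_mx polyC (invmx P) *m char_poly_mx D *m map_mx polyC P.
  rewrite /char_poly_mx mulmxBr mulmxBl -!map_mxM; congr (_ - _).
  by rewrite scalar_mxC -mulmxA -map_mxM mulVmx // map_mx1 mulmx1.
rewrite !det_mulmx mulrAC -det_mulmx -map_mxM mulVmx //.
by rewrite map_mx1 det1 mul1r.
Qed.

(** Over the complexification the matrix is Hermitian, so the spectral theorem diagonalizes it with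
    real eigenvalues. The factorization descends because the embedding is injective on
    polynomials. *)
Lemma symmetric_char_poly_split (L : rcfType) n (A : 'M[L]_n) : A^T = A ->
  exists s : seq L, char_poly A = \prod_(l <- s) ('X - l%:P).
Proof.
move=> symA; pose f := @real_complex_def L (Phant L).
pose B : 'M[complex L]_n := map_mx f A.
have hB : B \is hermsymmx.
  apply: realsym_hermsym; first last.
    by apply/mxOverP => i j; rewrite mxE; apply/complex_realP; exists (A i j).
  by apply/is_hermitianmxP; apply/matrixP => i j; rewrite expr0 scale1r !mxE -[in LHS]symA mxE.
have /orthomx_spectralP eB := hermitian_normalmx hB.
have /mxOverP dreal := hermitian_spectral_diag_real hB.
exists [seq complex.Re (spectral_diag B 0 i) | i <- enum 'I_n].
apply: (map_poly_inj f); rewrite map_char_poly -/B {1}eB.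
rewrite char_poly_conj ?spectral_unit // char_poly_trig ?diag_mx_is_trig //.
rewrite big_map big_enum rmorph_prod /=; apply: eq_bigr => i _.
by rewrite rmorphB /= map_polyX map_polyC /= !mxE eqxx mulr1n RRe_real ?dreal.
Qed.

(** At an eigenvector the quadratic form is [l] times a positive sum of squares. *)
Lemma posdef_eigenvalue_gt0 (L : rcfType) n (A : 'M[L]_n) (l : L) :
  (forall x : 'cV[L]_n, x != 0 -> 0 < (x^T *m A *m x) 0 0) ->
  root (char_poly A) l -> 0 < l.
Proof.
move=> hpd; rewrite -eigenvalue_root_char => /eigenvalueP[u uA u0].
have := hpd u^T; rewrite trmxK uA -scalemxAl mxE.
rewrite -(inj_eq trmx_inj) trmxK trmx0 => /(_ u0); rewrite pmulr_lgt0 //.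
rewrite mxE lt_def sumr_ge0 => [|i _]; last by rewrite !mxE -expr2 sqr_ge0.
rewrite andbT; apply: contra u0.
rewrite psumr_eq0 => [/allP h|i _]; last by rewrite !mxE -expr2 sqr_ge0.
apply/eqP/rowP => i; have := h i (mem_index_enum _).
by rewrite !mxE /= mulf_eq0 orbb => /eqP.
Qed.

(** * Valuations of sums, products and determinants *)

Section Valuation.
Variables (L : realFieldType) (G : ordZmodType).
Variables (hG : totally_ordered_abelian_group G) (v : L -> option G).
Hypothesis hv : convex_valuation v.
Implicit Types (x y : L) (g : G).

Lemma v_eq0 x : v x = None <-> x = 0.
Proof. by case: hv. Qed.

Lemma vM x y : v (x * y) = oadd (v x) (v y).
Proof. by case: hv => _ []. Qed.

Lemma vD_le x y : ole (v (x + y)) (v x) || ole (v (x + y)) (v y).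
Proof. by case: hv => _ [_ []]. Qed.

Lemma v_neq0 x : x != 0 -> exists g, v x = Some g.
Proof. by case e: (v x) => [g|]; [exists g|move/v_eq0: e => ->; rewrite eqxx]. Qed.

Lemma og_double_eq0 (g : G) : g + g = 0 -> g = 0.
Proof.
case: (comparable_ltgtP (og_cmp hG g 0)) => // h e.
  by have := og_double_lt hG g 0; rewrite e h addr0 ltxx.
by have := og_double_lt hG 0 g; rewrite e h addr0 ltxx.
Qed.

Lemma v1 : v 1 = Some 0.
Proof.
have [g hg] := v_neq0 (oner_neq0 L).
have := vM 1 1; rewrite mulr1 hg /= => -[] /(congr1 (fun c : G => c - g)).
by rewrite addrK subrr => <-.
Qed.

Lemma vN x : v (- x) = v x.
Proof.
have [g hg] : exists g, v (-1) = Some g by apply: v_neq0; rewrite oppr_eq0 oner_eq0.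
have := vM (-1) (-1); rewrite mulrNN mulr1 v1 hg /= => -[] /esym/og_double_eq0 g0.
by rewrite -mulN1r vM hg g0; case: (v x) => //= a; rewrite add0r.
Qed.

Definition vlt x g := if v x is Some a then a < g else true.

Lemma vlt_add x y g : vlt x g -> vlt y g -> vlt (x + y) g.
Proof.
rewrite /vlt; have := vD_le x y.
case: (v (x + y)) => // c; case: (v x) => [a|] /=; case: (v y) => [b|] //=.
- by case/orP => h ha hb; apply: le_lt_trans h _.
- by rewrite orbF => h ha _; apply: le_lt_trans h _.
by move=> h _ hb; apply: le_lt_trans h _.
Qed.

Lemma vlt_sum (I : Type) (r : seq I) (P : pred I) (F : I -> L) g :
  (forall i, P i -> vlt (F i) g) -> vlt (\sum_(i <- r | P i) F i) g.
Proof.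
move=> h; apply: (big_ind (fun x => vlt x g)) => //.
  by rewrite /vlt (v_eq0 0).2.
by move=> x y; apply: vlt_add.
Qed.

Lemma v_add_dominant x y g : v x = Some g -> vlt y g -> v (x + y) = Some g.
Proof.
(* Writing [x] as [(x + y) - y] gives the lower bound on [v (x + y)]. *)
move=> hx hy; have := vD_le x y; have := vD_le (x + y) (- y).
rewrite addrK vN hx; move: hy; rewrite /vlt.
case: (v y) => [b|] //=; case: (v (x + y)) => [c|] //=; rewrite ?orbF.
- move=> bg; rewrite [_ <= b]lt_geF // orbF => gc /orP[cg|cb].
    by congr Some; apply/le_anti; rewrite cg.
  by have := le_lt_trans (le_trans gc cb) bg; rewrite ltxx.
- by move=> bg; rewrite lt_geF.
by move=> _ gc cg; congr Some; apply/le_anti; rewrite cg.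
Qed.

(** Positive elements cannot cancel: by convexity [v (x + y)] is at least [v x] and [v y]. *)
Lemma v_add_gt0 x y (a b : G) : 0 < x -> 0 < y -> v x = Some a -> v y = Some b ->
  v (x + y) = Some (Order.max a b).
Proof.
move=> x0 y0 vx vy; case: hv => _ [_ [_ [mon _]]].
have := mon x (x + y) x0; rewrite lerDl ltW // => /(_ isT).
have := mon y (x + y) y0; rewrite lerDr ltW // => /(_ isT).
have := vD_le x y; rewrite vx vy; case: (v (x + y)) => //= c cab bc ac.
congr Some; move: cab; case: (comparable_ltgtP (og_cmp hG a b)) => [ab|ba|<-].
- by case/orP => h; apply/le_anti; rewrite ?h ?bc // (le_trans h (ltW ab)).
- by case/orP => h; apply/le_anti; rewrite ?h ?ac // (le_trans h (ltW ba)).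
by rewrite orbb => h; apply/le_anti; rewrite h ac.
Qed.

Lemma v_prod (I : eqType) (r : seq I) (F : I -> L) (f : I -> G) :
  {in r, forall i, v (F i) = Some (f i)} ->
  v (\prod_(i <- r) F i) = Some (\sum_(i <- r) f i).
Proof.
elim: r => [|a r ih] h; first by rewrite !big_nil v1.
rewrite !big_cons vM h ?mem_head // ih // => i ir.
by apply: h; rewrite inE ir orbT.
Qed.

(** By [og_sum_perm_lt] each term of a permutation other than the identity has value strictly below
    that of the diagonal product, which thus determines the value of the expansion. *)
Lemma v_det_dominant n (M : 'M[L]_n) (g : 'I_n -> G) :
  (forall i, v (M i i) = Some (g i)) ->
  (forall i j a, i != j -> v (M i j) = Some a -> a + a < g i + g j) ->
  v (\det M) = Some (\sum_i g i).
Proof.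
move=> hd ho; rewrite /determinant (bigD1 1%g) //= odd_perm1 expr0 mul1r.
apply: v_add_dominant.
  by rewrite (eq_bigr (fun i => M i i)) => [|i _]; rewrite ?perm1 //; apply: v_prod.
apply: vlt_sum => s s1.
have -> : vlt ((-1) ^+ s * \prod_i M i (s i)) (\sum_i g i) =
          vlt (\prod_i M i (s i)) (\sum_i g i).
  by rewrite /vlt; case: (odd_perm s); rewrite ?expr1 ?mulN1r ?vN ?expr0 ?mul1r.
have [/existsP[i /eqP Mi]|nz] := boolP [exists i, M i (s i) == 0].
  by rewrite /vlt (bigD1 i) //= Mi mul0r (v_eq0 0).2.
pose f i := odflt 0 (v (M i (s i))).
have hf i : v (M i (s i)) = Some (f i).
  by move/existsPn/(_ i): nz => /v_neq0[a e]; rewrite /f e.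
have [j hj] := perm_neq1_moves s1.
rewrite /vlt (v_prod (f := f)) => [|i _]; last exact: hf.
apply: (@og_sum_perm_lt _ hG _ s _ _ j); last exact: ho.
move=> i; have [/eqP ij|ij] := boolP (i == s i); last exact/ltW/ho.
by have := hf i; rewrite -ij hd => -[<-].
Qed.

Lemma sv_neq0 x s a : sv v x = SElt s a -> v x = Some a.
Proof.
rewrite /sv /ssgn; case e : (v x) => [c|] /=; last first.
  by case: ifP => // _; case: ifP.
by case: ifP => _; [|case: ifP => _ //]; rewrite /= add0r => -[_ ->].
Qed.

Lemma sv_gt0 x a : sv v x = SElt SPl a <-> 0 < x /\ v x = Some a.
Proof.
split=> [h|[x0 vx]]; last by rewrite /sv /ssgn x0 vx /= add0r.
split; last exact: sv_neq0 h.
move: h; rewrite /sv /ssgn; case: ifP => // _; case: ifP => // _.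
by case: (v x).
Qed.

End Valuation.

(** When [c] is the maximum of one list, all terms of its sum equal [c], so a larger entry of the
    other list would make the other sum strictly larger. Hence the maxima agree and can be removed
    from both lists. *)
Lemma perm_eq_sum_max (G : ordZmodType) (hG : totally_ordered_abelian_group G)
    (s t : seq G) : size s = size t ->
  (forall c, \sum_(x <- s) Order.max c x = \sum_(x <- t) Order.max c x) ->
  perm_eq s t.
Proof.
have [n] := ubnP (size s); elim: n => // n ih in s t *; rewrite ltnS => sn st h.
have [s0|sn0] := eqVneq s [::].
  by move: st; rewrite s0 /= => /esym/size0nil->.
have tn0 : t != [::] by rewrite -size_eq0 -st size_eq0.
have [x xs hx] := og_has_max hG sn0.
have [y yt hy] := og_has_max hG tn0.
have max_le (s1 s2 : seq G) x1 y1 : size s1 = size s2 ->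
    (forall c, \sum_(x <- s1) Order.max c x = \sum_(x <- s2) Order.max c x) ->
    (forall z, z \in s1 -> z <= x1) -> y1 \in s2 -> y1 <= x1.
  move=> st1 h1 hx1 yt1; case/orP: (og_cmp hG y1 x1) => // le.
  case: (comparable_ltgtP (og_cmp hG y1 x1)) => // lt.
  have : \sum_(z <- s2) x1 < \sum_(z <- s2) Order.max x1 z.
    apply: (@og_sum_lt _ hG _ _ _ _ y1) => // [z|].
      by rewrite (comparable_le_max _ (og_cmp hG _ _)) lexx.
    by rewrite (comparable_lt_max _ (og_cmp hG _ _)) lt orbT.
  rewrite -h1 [X in _ < X](eq_big_seq (fun=> x1)) => [|z zs]; last first.
    by have /= := hx1 z zs; case: (comparable_ltgtP (og_cmp hG x1 z)).
  by rewrite !big_const_seq !count_predT st1 ltxx.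
have exy : x = y.
  apply/le_anti; rewrite (max_le t s) ?(max_le s t) // => c; exact/esym.
rewrite -exy in yt; have ps := perm_to_rem xs; have pt := perm_to_rem yt.
rewrite (permPl ps) perm_sym (permPl pt) perm_cons perm_sym.
apply: ih => [||c].
- by rewrite size_rem // prednK // lt0n size_eq0.
- by rewrite !size_rem // st.
by have := h c; rewrite (perm_big _ ps) (perm_big _ pt) !big_cons => /addrI.
Qed.

Lemma horner_char_poly (R : comNzRingType) n (M : 'M[R]_n) (x : R) :
  (char_poly M).[x] = \det (x%:M - M).
Proof.
rewrite horner_sum; apply: eq_bigr => s _.
rewrite hornerM horner_exp !hornerE horner_prod; congr (_ * _).
by apply: eq_bigr => i _; rewrite !mxE !(hornerE, hornerMn).
Qed.

(** At a negative point [- t] each factor [- t - l] is minus a sum of positive elements, so its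
    value is [Order.max c (f l)]. The diagonal of [- t I - A] behaves likewise, and its determinant
    yields the matching sum over [d]. *)
Lemma eigenvalue_valuations (L : rcfType) (G : ordZmodType)
    (hG : totally_ordered_abelian_group G) (v : L -> option G)
    (hv : convex_valuation v) n (A : 'M[L]_n) (d : 'I_n -> G) (s : seq L)
    (f : L -> G) :
  (forall i, 0 < A i i /\ v (A i i) = Some (d i)) ->
  (forall i j a, i != j -> v (A i j) = Some a -> a + a < d i + d j) ->
  char_poly A = \prod_(l <- s) ('X - l%:P) ->
  {in s, forall l, 0 < l /\ v l = Some (f l)} ->
  perm_eq (map f s) [seq d i | i <- enum 'I_n].
Proof.
move=> hd ho hs hf; apply: (perm_eq_sum_max hG) => [|c].
  have := size_char_poly A; rewrite hs size_prod_XsubC => -[].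
  by rewrite (size_map f) (size_map d) size_enum_ord.
have [t t0 vt] : exists2 t : L, 0 < t & v t = Some c.
  have [_ [_ [_ [_ /(_ c)[t vt]]]]] := hv.
  exists `|t|; last by case: (ger0P t); rewrite ?(vN hG hv).
  by rewrite normr_gt0; apply/eqP => /(v_eq0 hv); rewrite vt.
have vadd x g : 0 < x -> v x = Some g -> v (- t - x) = Some (Order.max c g).
  by move=> x0 vx; rewrite -opprD (vN hG hv) (v_add_gt0 hG hv t0 x0 vt vx).
have : v (char_poly A).[- t] = v (char_poly A).[- t] by [].
rewrite {1}hs horner_char_poly horner_prod.
rewrite (v_prod hv (f := fun l => Order.max c (f l))); last first.
  by move=> l /hf[l0 vl]; rewrite /= hornerXsubC; apply: vadd.
rewrite (v_det_dominant hG hv (g := fun i => Order.max c (d i))) => [[]|i|i j a ij].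
- by rewrite (big_map f) (big_map d) big_enum.
- by have [? ?] := hd i; rewrite !mxE eqxx mulr1n; apply: vadd.
(* Off the diagonal the entries are those of [- A], and replacing [d] by its maximum with [c] only
   relaxes the bound. *)
rewrite !mxE (negPf ij) mulr0n add0r (vN hG hv) => /(ho _ _ _ ij) lt.
apply: lt_le_trans lt _; apply: og_leD => //.
all: by rewrite (comparable_le_max _ (og_cmp hG _ _)) lexx orbT.
Qed.

(** * Comparison of the tropical and the valued sides *)

Unset Implicit Arguments.

Theorem theorem6p3
  (L : rcfType) (G : ordZmodType)
  (hG : totally_ordered_abelian_group G) (hdiv : divisible_group G)
  (v : L -> option G) (hv : convex_valuation v)
  (n : nat) (A : 'M[smax G]_n) (hA : TPD A)
  (AA : 'M[L]_n)
  (hsym : AA^T = AA)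
  (hpd : forall x : 'cV[L]_n, x != 0 -> 0 < (x^T *m AA *m x) 0 0)
  (hsv : forall i j, sv v (AA i j) = A i j) :
  (* the eigenvalues of AA, counted with multiplicities, are the elements of s *)
  exists s : seq L,
    char_poly AA = \prod_(l <- s) ('X - l%:P) /\
    (* their signed valuations coincide with the algebraic S_max-eigenvalues
       of A counted with multiplicities, which are the diagonal entries of A *)
    (forall g : smax G, ssigned g ->
       smult (scharpoly A) g (count (fun l => sv v l == g) s) /\
       count (fun l => sv v l == g) s = count (fun i => A i i == g) (enum 'I_n)) /\
    (forall g : smax G, ssigned g ->
       (snabla (sdet (sshift g A)) SZero <-> exists i, A i i = g)).
Proof.
pose d i := smod (A i i); pose f l := odflt 0 (v l).
have dA i : A i i = SElt SPl (d i) by apply: TPD_diag hA i.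
have [s hs] := symmetric_char_poly_split hsym.
have hf : {in s, forall l, 0 < l /\ v l = Some (f l)}.
  move=> l ls; have l0 : 0 < l.
    by apply: (posdef_eigenvalue_gt0 hpd); rewrite hs root_prod_XsubC.
  by split=> //; have [c e] := v_neq0 hv (lt0r_neq0 l0); rewrite /f e.
have ps : perm_eq (map f s) [seq d i | i <- enum 'I_n].
  apply: (eigenvalue_valuations hG hv) hs hf => [i|i j a ij va].
    by apply/sv_gt0; rewrite hsv dA.
  case e : (A i j) => [|t b]; last first.
    have := @sv_neq0 _ _ v (AA i j) t b; rewrite hsv e va => /(_ erefl)[->].
    exact: TPD_offdiag hA _ _ _ _ ij e.
  (* A zero entry of [A] comes from an entry of value [⊥], contrary to [va]. *)
  move: e va; rewrite -hsv /sv /ssgn.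
  case: ltgtP => [_|_|<-]; last by rewrite (v_eq0 hv 0).2.
    by case: (v _).
  by case: (v _).
have rp : smx_poly hG (scharpoly A) = rootpoly hG [seq d i | i <- enum 'I_n].
  rewrite (smx_poly_scharpolyE hG hA) /rootpoly (big_map d) big_enum.
  by apply: eq_bigr => i _; rewrite dA.
have cntA g : count (fun c => SElt SPl c == g) [seq d i | i <- enum 'I_n] =
    count (fun i => A i i == g) (enum 'I_n).
  by rewrite count_map; apply: eq_count => i /=; rewrite dA.
exists s; split=> //; split=> g hg.
  (* Eigenvalues are positive, so their signed valuations are the positive elements of modulus
     [f l], and the counts reduce to the multisets of moduli in [ps]. *)
  have e : count (fun l => sv v l == g) s = count (fun i => A i i == g) (enum 'I_n).
    rewrite -cntA -(seq.permP ps) count_map; apply: eq_in_count => l /hf hl /=.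
    by have /sv_gt0-> := hl.
  by split=> //; rewrite e -cntA; apply: smult_rootpoly rp hg.
(* The determinant is the product of the [g ⊖ a_ii], balanced exactly when one factor is. *)
rewrite (snablax0 hG) (sdet_sshift (hG := hG) hA).
have -> : \prod_i ((g : smx hG) + (sopp (A i i) : smx hG)) =
    (rootpoly hG [seq d i | i <- enum 'I_n]).[g].
  rewrite rootpoly_horner (big_map d) big_enum.
  by apply: eq_bigr => i _; rewrite dA.
rewrite rootpoly_horner sbalanced_prod // has_map.
split=> [/hasP[i _ /eqP <-]|[i <-]]; first by exists i.
by apply/hasP; exists i; rewrite ?mem_enum //= dA.
Qed.
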